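(* Let $E=\{1,\ldots,K\}$, let $n\in\mathbb{N}$, and let $(x_{i,1},\hat z_1,z_1,y_1),\ldots,(x_{i,n},\hat z_n,z_n,y_n)$ be observations with $x_{i,k},y_k\in\mathbb{R}$ and $z_k,\hat z_k\in E$. Let $\widehat\beta_i^{\mathrm{sub}}$, $\hat\beta_i$, $\alpha$, $\delta$ and $\rho$ be computed from these observations as defined in the context. If $\alpha>0$ and $\rho>0$, then $$|\widehat\beta_i^{\mathrm{sub}}-\hat\beta_i|\leq\frac{2\sqrt2}{\rho^2}\sqrt{\frac{\delta}{\alpha}}\,\frac{\|\mathbf{y}\|_2}{\|\mathbf{x}_i\|_2}.$$
   Context: The index $i$ is fixed. Here $z_k$ is the (unobserved) latent variable and $\hat z_k$ its substitute. Write $\mathbf{x}_i=(x_{i,1},\ldots,x_{i,n})^T$, $\mathbf{y}=(y_1,\ldots,y_n)^T$, with $\|\cdot\|_2$ the Euclidean norm. For $z\in E$ let $$n(z)=\sum_{k=1}^n1(z_k=z),\qquad\hat n(z)=\sum_{k=1}^n1(\hat z_k=z),\qquad n_{\min}=\min\{n(1),\ldots,n(K),\hat n(1),\ldots,\hat n(K)\},$$ $$\overline\mu_i(z)=\frac1{n(z)}\sum_{k:z_k=z}x_{i,k},\quad\overline g(z)=\frac1{n(z)}\sum_{k:z_k=z}y_k,\quad\hat\mu_i(z)=\frac1{\hat n(z)}\sum_{k:\hat z_k=z}x_{i,k},\quad\hat g(z)=\frac1{\hat n(z)}\sum_{k:\hat z_k=z}y_k.$$ The substitute adjustment estimator and the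 oracle estimator are $$\widehat\beta_i^{\mathrm{sub}}=\frac{\sum_{k=1}^n(x_{i,k}-\hat\mu_i(\hat z_k))(y_k-\hat g(\hat z_k))}{\sum_{k=1}^n(x_{i,k}-\hat\mu_i(\hat z_k))^2},\qquad\hat\beta_i=\frac{\sum_{k=1}^n(x_{i,k}-\overline\mu_i(z_k))(y_k-\overline g(z_k))}{\sum_{k=1}^n(x_{i,k}-\overline\mu_i(z_k))^2}.$$ Finally, $$\alpha=\frac{n_{\min}}n,\qquad\delta=\frac1n\sum_{k=1}^n1(\hat z_k\neq z_k),\qquad\rho=\frac{\min\left\{\sum_{k=1}^n(x_{i,k}-\overline\mu_i(z_k))^2,\ \sum_{k=1}^n(x_{i,k}-\hat\mu_i(\hat z_k))^2\right\}}{\|\mathbf{x}_i\|_2^2}$$ (the definition of $\rho$ presupposes $\mathbf{x}_i\neq0$). *)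

(* Defs.v *)
From mathcomp Require Import all_boot all_order all_algebra.
From mathcomp Require Import reals.

Set Implicit Arguments.
Unset Strict Implicit.
Unset Printing Implicit Defensive.

Import Order.TTheory GRing.Theory Num.Theory.
Local Open Scope ring_scope.

(* Conventions: the observations are indexed by 'I_n, the label set E is 'I_K,
   a labelling is a map 'I_n -> 'I_K (either the latent z or its substitute zh),
   and x is the row (x_{i,1}, ..., x_{i,n}) for the fixed index i. *)

Definition group_size (n K : nat) (z : 'I_n -> 'I_K) (e : 'I_K) : nat :=
  (\sum_(k < n) (z k == e))%N.

Definition group_mean (R : realType) (n K : nat) (z : 'I_n -> 'I_K)
    (x : 'I_n -> R) (e : 'I_K) : R :=
  (group_size z e)%:R^-1 * \sum_(k < n | z k == e) x k.

Definition residual (R : realType) (n K : nat) (z : 'I_n -> 'I_K)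
    (x : 'I_n -> R) (k : 'I_n) : R :=
  x k - group_mean z x (z k).

Definition residual_ss (R : realType) (n K : nat) (z : 'I_n -> 'I_K)
    (x : 'I_n -> R) : R :=
  \sum_(k < n) residual z x k ^+ 2.

Definition adjusted_estimator (R : realType) (n K : nat) (z : 'I_n -> 'I_K)
    (x y : 'I_n -> R) : R :=
  (\sum_(k < n) residual z x k * residual z y k) / residual_ss z x.

Definition beta_sub (R : realType) (n K : nat) (zh : 'I_n -> 'I_K)
    (x y : 'I_n -> R) : R :=
  adjusted_estimator zh x y.

Definition beta_oracle (R : realType) (n K : nat) (z : 'I_n -> 'I_K)
    (x y : 'I_n -> R) : R :=
  adjusted_estimator z x y.

(* The initial value n does not affect the minimum when K > 0, since every
   group size is at most n; K = 0 forces n = 0. *)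
Definition n_min (n K : nat) (z zh : 'I_n -> 'I_K) : nat :=
  \big[minn/n]_(e < K) minn (group_size z e) (group_size zh e).

(* The library norm on matrices is the sup norm, hence this definition. *)
Definition norm2 (R : realType) (n : nat) (x : 'I_n -> R) : R :=
  Num.sqrt (\sum_(k < n) x k ^+ 2).

Definition alpha (R : realType) (n K : nat) (z zh : 'I_n -> 'I_K) : R :=
  (n_min z zh)%:R / n%:R.

Definition delta (R : realType) (n K : nat) (z zh : 'I_n -> 'I_K) : R :=
  n%:R^-1 * \sum_(k < n) (zh k != z k)%:R.

(* Division by zero gives 0, so rho = 0 when x = 0: the hypothesis 0 < rho
   entails x <> 0. Likewise 0 < alpha entails 0 < n. *)
Definition rho (R : realType) (n K : nat) (z zh : 'I_n -> 'I_K)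
    (x : 'I_n -> R) : R :=
  Num.min (residual_ss z x) (residual_ss zh x) / norm2 x ^+ 2.

(* Main.v *)
Require Import Defs.
From mathcomp Require Import all_boot all_order all_algebra.
From mathcomp Require Import reals.
From mathcomp Require Import ring lra.
Set Implicit Arguments.
Unset Strict Implicit.
Unset Printing Implicit Defensive.

Import Order.TTheory GRing.Theory Num.Theory.
Local Open Scope ring_scope.

(** Subtracting the group means of a labelling [z] is the orthogonal projection
    [I - P] of R^n along the space of functions that are constant on the groups
    of [z]; let [P'] be the projection belonging to [zh].  Write
    [u = (I - P) x] and [u' = (I - P') x].  By orthogonality the two estimators
    are [<u, y> / |u|^2] and [<u', y> / |u'|^2], so their difference is the inner
    product of [y] with the difference of the images of [u'] and [u] under the
    inversion in the unit sphere, and an inversion satisfies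
    [|u'/|u'|^2 - u/|u|^2| = |u' - u| / (|u'| |u|)].  Since [|u|^2] and [|u'|^2]
    are at least [rho |x|^2], only [|u' - u| = |P x - P' x|] is left to bound
    ([adjusted_estimator_gap]).

    The difference of two orthogonal projections splits orthogonally as
    [P x - P' x = P (I - P') x - (I - P) P' x].  The second part is controlled
    by the observation that a function [a (zh k)] is close to the function
    [a (z k)], which [I - P] annihilates: they differ only where the labels
    disagree, and there by little, because a value taken by a function on a
    whole group of at least [m] observations is at most the norm of the function
    over [sqrt m] ([relabelling_gap]).  The first part is controlled by duality,
    as [P (I - P')] is the adjoint of [(I - P') P].  Altogether
    [|P x - P' x|^2 <= 2 (delta / alpha) |x|^2] ([ssq_residual_gap]).  This gives
    the bound with [sqrt 2 / rho] in place of [2 sqrt 2 / rho^2], and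
    [rho <= 1]. *)

(** * Inner products *)

Definition dot (R : realType) (n : nat) (f g : 'I_n -> R) : R :=
  \sum_(k < n) f k * g k.

Definition ssq (R : realType) (n : nat) (f : 'I_n -> R) : R :=
  \sum_(k < n) f k ^+ 2.

Section InnerProduct.
Context (R : realType) (n : nat).
Implicit Types f g h : 'I_n -> R.

Lemma dotC f g : dot f g = dot g f.
Proof. by apply: eq_bigr => k _; rewrite mulrC. Qed.

Lemma dot_subl f g h : dot (f \- g) h = dot f h - dot g h.
Proof. by rewrite /dot -sumrB; apply: eq_bigr => k _; rewrite -mulrBl. Qed.

Lemma ssqE f : ssq f = dot f f.
Proof. by apply: eq_bigr => k _; rewrite expr2. Qed.

Lemma ssq_ge0 f : 0 <= ssq f.
Proof. by apply: sumr_ge0 => k _; rewrite sqr_ge0. Qed.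

Lemma ssq_lincomb (a b : R) f g :
  ssq (fun k => a * f k - b * g k)
  = a ^+ 2 * ssq f - 2 * a * b * dot f g + b ^+ 2 * ssq g.
Proof.
rewrite /ssq /dot !mulr_sumr -sumrB -big_split /=.
by apply: eq_bigr => k _; ring.
Qed.

Lemma ssqB f g : ssq (f \- g) = ssq f - 2 * dot f g + ssq g.
Proof.
have := ssq_lincomb 1 1 f g; rewrite expr1n !mul1r !mulr1 => <-.
by apply: eq_bigr => k _; rewrite !mul1r.
Qed.

Lemma dot_CauchySchwarz f g : dot f g ^+ 2 <= ssq f * ssq g.
Proof.
have [g0|gN0] := eqVneq (ssq g) 0.
  have gk k : g k = 0.
    apply/eqP; rewrite -(@sqrf_eq0 R); apply/eqP.
    by apply: (psumr_eq0P (fun k _ => sqr_ge0 (g k)) g0).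
  rewrite g0 mulr0 /dot big1 ?expr0n // => k _.
  by rewrite gk mulr0.
have gt0 : 0 < ssq g by rewrite lt_def gN0 ssq_ge0.
have := ssq_ge0 (fun k => ssq g * f k - dot f g * g k).
rewrite ssq_lincomb => H.
(* The squared norm in [H] is [ssq g] times the gap in the inequality. *)
rewrite -subr_ge0 -(pmulr_rge0 _ gt0).
by apply: le_trans H _; rewrite le_eqVlt; apply/orP; left; apply/eqP; ring.
Qed.

(** Normalizing by the squared norm is the inversion in the unit sphere, which
    scales distances by [1 / (|f| |g|)]; the rest is Cauchy-Schwarz. *)
Lemma inversion_gap f g h : 0 < ssq f -> 0 < ssq g ->
  (dot f h / ssq f - dot g h / ssq g) ^+ 2
  <= ssq (f \- g) / (ssq f * ssq g) * ssq h.
Proof.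
move=> f0 g0.
have -> : dot f h / ssq f - dot g h / ssq g
          = dot (fun k => (ssq f)^-1 * f k - (ssq g)^-1 * g k) h.
  rewrite /dot !mulr_suml -sumrB; apply: eq_bigr => k _; ring.
apply: le_trans (dot_CauchySchwarz _ _) _.
rewrite ssq_lincomb ssqB le_eqVlt; apply/orP; left; apply/eqP.
by field; rewrite !gt_eqF.
Qed.

End InnerProduct.

(** * Group means as orthogonal projections *)

Definition fitted (R : realType) (n K : nat) (z : 'I_n -> 'I_K)
    (x : 'I_n -> R) (k : 'I_n) : R :=
  group_mean z x (z k).

Section Projection.
Context (R : realType) (n K : nat) (z : 'I_n -> 'I_K).
Implicit Types (f x y : 'I_n -> R) (a : 'I_K -> R).

Lemma group_sizeE e : (group_size z e)%:R = \sum_(k < n | z k == e) 1 :> R.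
Proof.
rewrite natr_sum [RHS]big_mkcond; apply: eq_bigr => k _.
by case: eqP.
Qed.

Lemma group_meanK x e :
  group_mean z x e * (group_size z e)%:R = \sum_(k < n | z k == e) x k.
Proof.
rewrite /group_mean; have [s0|sN0] := eqVneq (group_size z e) 0%N; last first.
  by rewrite mulrAC mulVf ?mul1r // pnatr_eq0.
(* In an empty group the sum has no terms, whatever value the mean takes. *)
rewrite s0 mulr0 big1 // => k /eqP zk.
by move: s0; rewrite /group_size (bigD1 k) //= zk eqxx.
Qed.

Lemma dot_residual_const x a : dot (residual z x) (a \o z) = 0.
Proof.
rewrite /dot (partition_big z predT) //= big1 // => e _.
have -> : \sum_(k < n | z k == e) residual z x k * a (z k)
  = (\sum_(k < n | z k == e) x k
     - group_mean z x e * \sum_(k < n | z k == e) 1) * a e.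
  rewrite mulr_sumr -sumrB mulr_suml; apply: eq_bigr => k /eqP <-.
  by rewrite mulr1.
by rewrite -group_sizeE group_meanK subrr mul0r.
Qed.

Lemma dot_residual_fitted x y : dot (residual z x) (fitted z y) = 0.
Proof. exact: dot_residual_const. Qed.

Lemma dot_residual x y : dot (residual z x) (residual z y) = dot (residual z x) y.
Proof. by rewrite dotC dot_subl dotC (dotC (fitted z y)) dot_residual_fitted subr0. Qed.

Lemma dot_fitted x y : dot (fitted z x) (fitted z y) = dot (fitted z x) y.
Proof.
apply/eqP; rewrite eq_sym -subr_eq0; apply/eqP.
by rewrite !(dotC (fitted z x)) -dot_subl dot_residual_fitted.
Qed.

Lemma fittedB x y k : fitted z (x \- y) k = fitted z x k - fitted z y k.
Proof. by rewrite /fitted /group_mean sumrB mulrBr. Qed.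

Lemma ssq_decomp x : ssq x = ssq (residual z x) + ssq (fitted z x).
Proof.
have := ssqB x (fitted z x).
rewrite -[ssq (x \- _)]/(ssq (residual z x)) dotC -dot_fitted -ssqE => ->.
by ring.
Qed.

(** Replacing the group means by other values [a] changes the approximation of
    [f] by a function of the labels, to which the residual is orthogonal, so
    Pythagoras shows that the group means are optimal. *)
Lemma ssq_residual_min f a : ssq (residual z f) <= ssq (f \- (a \o z)).
Proof.
(* [d] is the function of the labels by which the two approximations differ. *)
pose d := fun e => a e - group_mean z f e.
have -> : ssq (f \- (a \o z)) = ssq (residual z f \- (d \o z)).
  by apply: eq_bigr => k _; rewrite /d /residual /=; congr (_ ^+ 2); ring.
by rewrite ssqB dot_residual_const mulr0 subr0 lerDl ssq_ge0.
Qed.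

Lemma ssq_const a : ssq (a \o z) = \sum_e (group_size z e)%:R * a e ^+ 2.
Proof.
rewrite /ssq (partition_big z predT) //=; apply: eq_bigr => e _.
rewrite group_sizeE mulr_suml; apply: eq_bigr => k /eqP <-.
by rewrite mul1r.
Qed.

(** The estimator only sees [y] through its inner product with the residual of
    [x], since that residual is orthogonal to the group means of [y]. *)
Lemma adjusted_estimatorE x y :
  adjusted_estimator z x y = dot (residual z x) y / ssq (residual z x).
Proof. by rewrite -dot_residual. Qed.

End Projection.

(** * Comparing the projections of two labellings *)

Definition mismatches (R : realType) (n K : nat) (z zh : 'I_n -> 'I_K) : R :=
  \sum_(k < n) (zh k != z k)%:R.

Section TwoLabellings.
Context (R : realType) (n K : nat).
Implicit Types (x f : 'I_n -> R) (a : 'I_K -> R) (z zh : 'I_n -> 'I_K) (m : nat).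

Lemma mismatchesC z zh : mismatches R z zh = mismatches R zh z.
Proof. by apply: eq_bigr => k _; rewrite eq_sym. Qed.

(** Two different groups occupy disjoint sets of at least [m] observations, so
    [m (a e ^+ 2 + a e' ^+ 2)] is at most the squared norm of [a \o z]; this
    bounds each of the terms at which the labels disagree. *)
Lemma relabelling_gap z zh m a : (forall e, (m <= group_size z e)%N) ->
  m%:R * ssq ((a \o z) \- (a \o zh)) <= 2 * mismatches R z zh * ssq (a \o z).
Proof.
move=> hm.
rewrite {1}/ssq mulr_sumr /mismatches [2 * _]mulr_sumr mulr_suml.
apply: ler_sum => k _ /=; have [->|neq] := eqVneq (zh k) (z k).
  by rewrite subrr expr0n !mulr0 mul0r.
(* The groups [z k] and [zh k] contribute separate terms to the norm. *)
have two : m%:R * (a (z k) ^+ 2 + a (zh k) ^+ 2) <= ssq (a \o z).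
  rewrite ssq_const (bigD1 (z k)) //= (bigD1 (zh k)) //= addrA mulrDr.
  apply: ler_wpDr.
    by apply: sumr_ge0 => e _; rewrite mulr_ge0 ?ler0n ?sqr_ge0.
  by apply: lerD; rewrite ler_wpM2r ?sqr_ge0 ?ler_nat.
rewrite mulr1; apply: (le_trans _ (ler_wpM2l _ two)); last by [].
rewrite [leRHS]mulrCA ler_wpM2l ?ler0n //.
have := sqr_ge0 (a (z k) + a (zh k)); nra.
Qed.

(** The function [a (zh k)], with [a] the group means for [z], competes in the
    best approximation of [a (z k)] by functions of [zh]. *)
Lemma ssq_residual_fitted z zh m x : (forall e, (m <= group_size z e)%N) ->
  m%:R * ssq (residual zh (fitted z x))
  <= 2 * mismatches R z zh * ssq (fitted z x).
Proof.
move=> hm; apply: le_trans (@relabelling_gap z zh m (group_mean z x) hm).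
by rewrite ler_wpM2l ?ler0n //; apply: ssq_residual_min.
Qed.

(** The adjoint form of [ssq_residual_fitted].  With [v = (I - P') x] and
    [w = P v] one has [|w|^2 = <v, w> = <v, (I - P') w>], where [(I - P') w] is
    bounded by [ssq_residual_fitted] in terms of [|w|]; Cauchy-Schwarz then
    bounds [|w|] by [|v|] with the same constant. *)
Lemma ssq_fitted_residual z zh m x : (forall e, (m <= group_size z e)%N) ->
  m%:R * ssq (fitted z (residual zh x))
  <= 2 * mismatches R z zh * ssq (residual zh x).
Proof.
move=> hm; set v := residual zh x; set w := fitted z v.
have wv : ssq w = dot v (residual zh w).
  by rewrite dot_residual ssqE dot_fitted dotC.
have gap : m%:R * ssq (residual zh w) <= 2 * mismatches R z zh * ssq w.
  exact: ssq_residual_fitted.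
have CS : ssq w ^+ 2 <= ssq v * ssq (residual zh w).
  by rewrite wv dot_CauchySchwarz.
have M0 : 0 <= mismatches R z zh by apply: sumr_ge0 => k _; rewrite ler0n.
have [w0|wN0] := eqVneq (ssq w) 0.
  by rewrite w0 mulr0 !mulr_ge0 ?ssq_ge0.
have wgt0 : 0 < ssq w by rewrite lt_def wN0 ssq_ge0.
rewrite -(ler_pM2r wgt0) -[leLHS]mulrA -expr2.
apply: (le_trans (ler_wpM2l (ler0n _ _) CS)).
rewrite mulrCA; apply: (le_trans (ler_wpM2l (ssq_ge0 _) gap)).
by rewrite le_eqVlt; apply/orP; left; apply/eqP; ring.
Qed.

(** [P x - P' x = P (I - P') x - (I - P) P' x] is an orthogonal sum, and
    [|(I - P') x|^2 + |P' x|^2 = |x|^2], so the bounds on the two parts,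
    which have the same constant, add up without loss.  The difference is
    written with residuals because this is what the inversion produces. *)
Lemma ssq_residual_gap z zh m x :
    (forall e, (m <= group_size z e)%N) -> (forall e, (m <= group_size zh e)%N) ->
  m%:R * ssq (residual zh x \- residual z x) <= 2 * mismatches R z zh * ssq x.
Proof.
move=> hz hzh.
have -> : ssq (residual zh x \- residual z x)
  = ssq (fitted z (residual zh x) \- residual z (fitted zh x)).
  apply: eq_bigr => k _ /=; congr (_ ^+ 2).
  have := fittedB z x (fitted zh x) k.
  rewrite -[x \- fitted zh x]/(residual zh x) => ->.
  by rewrite /residual -!/(fitted _ _ _); ring.
rewrite ssqB dotC dot_residual_fitted mulr0 subr0 (ssq_decomp zh x) !mulrDr.
apply: lerD; first exact: ssq_fitted_residual.
by rewrite mismatchesC; apply: ssq_residual_fitted.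
Qed.

Lemma adjusted_estimator_gap z zh m x y (c : R) :
    (0 < m)%N ->
    (forall e, (m <= group_size z e)%N) -> (forall e, (m <= group_size zh e)%N) ->
    0 < c -> 0 < ssq x ->
    c * ssq x <= ssq (residual z x) -> c * ssq x <= ssq (residual zh x) ->
  (adjusted_estimator zh x y - adjusted_estimator z x y) ^+ 2
  <= 2 * (mismatches R z zh / m%:R) / c ^+ 2 * (ssq y / ssq x).
Proof.
move=> m0 hz hzh c0 x0 cz czh.
have cx0 : 0 < c * ssq x by rewrite mulr_gt0.
have rz0 : 0 < ssq (residual z x) by apply: lt_le_trans cz.
have rzh0 : 0 < ssq (residual zh x) by apply: lt_le_trans czh.
rewrite !adjusted_estimatorE.
apply: le_trans (inversion_gap _ rzh0 rz0) _.
have -> : 2 * (mismatches R z zh / m%:R) / c ^+ 2 * (ssq y / ssq x)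
  = (2 * mismatches R z zh * ssq x / m%:R) / (c * ssq x * (c * ssq x)) * ssq y.
  by field; rewrite !gt_eqF ?ltr0n.
rewrite ler_wpM2r ?ssq_ge0 //.
apply: ler_pM.
- exact: ssq_ge0.
- by rewrite invr_ge0 mulr_ge0 ?ssq_ge0.
- by rewrite ler_pdivlMr ?ltr0n // mulrC ssq_residual_gap.
- by rewrite lef_pV2 ?posrE ?mulr_gt0 // ler_pM // ltW.
Qed.

Lemma n_min_le z zh e :
  (n_min z zh <= group_size z e)%N /\ (n_min z zh <= group_size zh e)%N.
Proof.
have : (n_min z zh <= minn (group_size z e) (group_size zh e))%N.
  rewrite /n_min; elim: (index_enum _) (mem_index_enum e) => [//|i s IH].
  by rewrite big_cons inE geq_min => /predU1P[->|/IH->]; rewrite ?leqnn ?orbT.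
by rewrite leq_min => /andP.
Qed.

End TwoLabellings.

Theorem theorem1 (R : realType) (K n : nat) (x y : 'I_n -> R)
    (z zh : 'I_n -> 'I_K)
    (halpha : 0 < alpha R z zh) (hrho : 0 < rho z zh x) :
  `|beta_sub zh x y - beta_oracle z x y|
    <= 2 * Num.sqrt 2 / rho z zh x ^+ 2
       * Num.sqrt (delta R z zh / alpha R z zh)
       * (norm2 y / norm2 x).
Proof.
set r := rho z zh x in hrho *.
have norm2_sq (f : 'I_n -> R) : norm2 f ^+ 2 = ssq f by rewrite sqr_sqrtr ?ssq_ge0.
have x0 : 0 < ssq x.
  rewrite lt_def ssq_ge0 andbT; apply: contraTneq hrho => x0.
  by rewrite /r /rho norm2_sq x0 invr0 mulr0 ltxx.
have rE : r * ssq x = Num.min (ssq (residual z x)) (ssq (residual zh x)).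
  by rewrite /r /rho norm2_sq divfK ?gt_eqF.
clearbody r.
have rz : r * ssq x <= ssq (residual z x) by rewrite rE ge_min lexx.
have rzh : r * ssq x <= ssq (residual zh x) by rewrite rE ge_min lexx orbT.
have r1 : r <= 1.
  by rewrite -(ler_pM2r x0) mul1r (le_trans rz) // (ssq_decomp z x) lerDl ssq_ge0.
have [n0 m0] : (0 < n)%N /\ (0 < n_min z zh)%N.
  move: halpha; rewrite /alpha; case: (posnP n) => [n0|n0].
    by rewrite {2}n0 invr0 mulr0 ltxx.
  by case: (posnP (n_min z zh)) => [-> |//]; rewrite mul0r ltxx.
have dE : delta R z zh / alpha R z zh = mismatches R z zh / (n_min z zh)%:R.
  rewrite /delta /alpha -/(mismatches R z zh).
  by field; rewrite !gt_eqF ?ltr0n.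
have d0 : 0 <= mismatches R z zh / (n_min z zh)%:R.
  by rewrite mulr_ge0 ?invr_ge0 ?ler0n // sumr_ge0 // => k _; rewrite ler0n.
have gap := @adjusted_estimator_gap R n K z zh _ x y r m0
  (fun e => (n_min_le z zh e).1) (fun e => (n_min_le z zh e).2) hrho x0 rz rzh.
rewrite dE; set q := _ / _ in d0 gap *.
rewrite -ler_sqr ?nnegrE ?normr_ge0 //; last first.
  by rewrite !mulr_ge0 ?invr_ge0 ?sqrtr_ge0 ?sqr_ge0.
rewrite real_normK ?num_real // !exprMn !exprVn !norm2_sq !sqr_sqrtr //.
apply: (le_trans gap); apply: ler_wpM2r.
  by rewrite mulr_ge0 ?invr_ge0 ?ssq_ge0.
have r2 : 1 <= (r ^+ 2)^-1 by rewrite invf_ge1 ?exprn_gt0 // exprn_ile1 // ltW.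
(* What is left is [2 / r ^+ 2 <= 8 / r ^+ 4]. *)
rewrite -(exprVn (r ^+ 2) 2) [leLHS]mulrAC ler_wpM2r //.
nra.
Qed.
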